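(* For every $n\in\mathbb{N}$ the graph $G(3,5,n)$ has a Hamiltonian path, and for every even $n>2$ the graph $G(3,5,n)$ is Hamiltonian (has a Hamiltonian cycle).
   Context: For a prime $p$ and $n\in\mathbb{N}$, $G(p,n)$ is the simple graph with vertex set $\{2,4,\ldots,2n\}$ in which two distinct vertices $a,b$ are adjacent if and only if both $\frac{a+b}{2}$ and $\frac{|a-b|}{2}$ are odd positive integers neither of which equals $pk$ for an integer $k\ge 2$. $G(3,5,n)$ is the intersection of $G(3,n)$ and $G(5,n)$: the graph on $\{2,4,\ldots,2n\}$ whose edge set is the intersection of their edge sets. *)

(* Defs.v *)
From mathcomp Require Import all_boot all_order ssralg ssrnum ssrint.
Set Implicit Arguments. Unset Strict Implicit. Unset Printing Implicit Defensive.

Record simple_graph (V : finType) := SimpleGraph {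
  adj :> rel V;
  adj_sym : symmetric adj;
  adj_irr : irreflexive adj
}.

Lemma inter_sym (V : finType) (G H : simple_graph V) :
  symmetric [rel a b | G a b && H a b].
Proof. by move=> a b; rewrite /= (adj_sym G) (adj_sym H). Qed.

Lemma inter_irr (V : finType) (G H : simple_graph V) :
  irreflexive [rel a b | G a b && H a b].
Proof. by move=> a; rewrite /= (adj_irr G). Qed.

Definition graph_inter (V : finType) (G H : simple_graph V) : simple_graph V :=
  SimpleGraph (@inter_sym V G H) (@inter_irr V G H).

(* A path is given by the sequence of its vertices; a one-vertex sequence is a
   path, and the empty sequence only matters for the graph without vertices. *)
Definition has_hamiltonian_path (V : finType) (G : simple_graph V) : Prop :=
  exists s : seq V, [/\ sorted G s, uniq s & forall v, v \in s].

(* [ucycle] alone accepts a single edge, traversed back and forth, as a cycle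
   of length 2; cycles of a simple graph have at least 3 vertices. *)
Definition hamiltonian (V : finType) (G : simple_graph V) : Prop :=
  exists s : seq V, [/\ ucycle G s, 2 < size s & forall v, v \in s].

(* The finite type {2, 4, ..., 2n}. *)
Definition vertex (n : nat) : finType := seq_sub [seq 2 * i | i <- iota 1 n].

(* m = p k for some k >= 2; the bound k <= m makes the quantifier finite and
   loses nothing when p > 0, see [proper_multipleP]. *)
Definition proper_multiple (p m : nat) : bool :=
  [exists k : 'I_m.+1, (2 <= k) && (m == p * k)].

Lemma proper_multipleP (p m : nat) : prime p ->
  reflect (exists2 k, 2 <= k & m = p * k) (proper_multiple p m).
Proof.
move=> /prime_gt0 p_gt0; apply: (iffP existsP) => [[k /andP[k2 /eqP ->]]|[k k2 E]].
  by exists k.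
have km : k < m.+1 by rewrite ltnS E leq_pmull.
by exists (Ordinal km); rewrite /= k2 -E eqxx.
Qed.

Definition admissible (p m : nat) : bool :=
  [&& odd m, 0 < m & ~~ proper_multiple p m].

(* On even labels the halvings are exact; the subtraction inside `|_| is the
   signed one of int. *)
Definition G_rel (p n : nat) : rel (vertex n) := fun a b =>
  [&& a != b, admissible p (val a + val b)./2
    & admissible p `|val a - val b|./2].

Lemma G_rel_sym (p n : nat) : symmetric (@G_rel p n).
Proof. by move=> a b; rewrite /G_rel eq_sym addnC distnC. Qed.

Lemma G_rel_irr (p n : nat) : irreflexive (@G_rel p n).
Proof. by move=> a; rewrite /G_rel eqxx. Qed.

Definition G (p n : nat) : simple_graph (vertex n) :=
  SimpleGraph (@G_rel_sym p n) (@G_rel_irr p n).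

Definition G35 (n : nat) : simple_graph (vertex n) :=
  graph_inter (G 3 n) (G 5 n).

(* Main.v *)
Require Import Defs.
From mathcomp Require Import all_boot.
From mathcomp Require Import ssrint zify.

Set Implicit Arguments.
Unset Strict Implicit.
Unset Printing Implicit Defensive.

(** Halving the labels, vertices become 1, ..., n; x and y are adjacent when
    x + y and |x - y| are odd and each of them is 3, 5 or coprime to 15.  When
    x + y > 5, adjacency survives the translation of both ends by a multiple of
    15.

    If a Hamiltonian path of {1, ..., N} runs from a to b, then a path through
    N + 1, ..., N + r from a neighbour of b to a neighbour of a closes it to a
    Hamiltonian cycle of {1, ..., N + r}.  For N = 4 and (a, b) = (3, 4) such
    closing paths exist for r = 4, 6, ..., 32, which represent all even residues
    modulo 30.  The one for r = 30 traverses the edge from 34 to 33: cutting it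
    there extends both ends of the path from 3 to 4, giving a Hamiltonian path
    of {1, ..., 34} from 33 to 34.  This is the original situation translated by
    30, so that the construction can be iterated, and it yields a Hamiltonian
    cycle for every even n > 6; smaller n are immediate.  For odd n > 1, the
    vertex n is adjacent to n - 1, n - 3 or n - 5; opening a Hamiltonian cycle
    of {1, ..., n - 1} at that neighbour and appending n gives a Hamiltonian
    path. *)

Section SpanningPaths.

Variables (T : eqType) (e : rel T).
Implicit Types (l p q s : seq T) (a b x y : T).

Definition traceable l : Prop := exists2 s, sorted e s & perm_eq s l.

(* As with [cycle], one edge traversed back and forth counts as a cycle. *)
Definition spanning_cycle l : Prop := exists2 s, cycle e s & perm_eq s l.

Definition spanning_path l a b : Prop :=
  exists s, [/\ path e a s, last a s = b & perm_eq (a :: s) l].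

Lemma spanning_path_extend l l' a b a' p q :
    spanning_path l a b ->
    path e a' (rcons p a) -> path e b q -> perm_eq (a' :: p ++ q) l' ->
  spanning_path (l ++ l') a' (last b q).
Proof.
case=> s [path_s last_s perm_s] path_p path_q perm_pq.
exists (p ++ a :: s ++ q); split.
- move: path_p; rewrite rcons_path cat_path /= cat_path last_s path_s path_q.
  by move=> /andP[-> ->].
- by rewrite last_cat /= last_cat last_s.
- apply: perm_trans (perm_cat perm_s perm_pq).
  exact: permEl (perm_catCA (a' :: p) (a :: s) q).
Qed.

Lemma spanning_path_close l l' a b q :
    spanning_path l a b -> path e b (rcons q a) -> perm_eq q l' ->
  spanning_cycle (l ++ l').
Proof.
case=> s [path_s last_s perm_s] path_q perm_q; exists (a :: s ++ q).
  by rewrite /= rcons_cat cat_path last_s path_s.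
exact: perm_cat perm_s perm_q.
Qed.

Lemma spanning_cycle_traceable l : spanning_cycle l -> traceable l.
Proof.
case=> -[|x s] cycle_s perm_s; first by exists [::].
by exists (x :: s) => //; move: cycle_s; rewrite /= rcons_path => /andP[].
Qed.

Lemma spanning_cycle_rcons l x y :
  spanning_cycle l -> y \in l -> e x y -> traceable (rcons l x).
Proof.
case=> s cycle_s perm_s; rewrite -(perm_mem perm_s) => /rot_to[i t rot_s] xy.
exists (x :: y :: t).
  move: cycle_s; rewrite -(rot_cycle i) rot_s /= rcons_path xy.
  by case/andP.
by rewrite -rot_s perm_sym perm_rcons perm_cons perm_sym perm_rot.
Qed.

End SpanningPaths.

Lemma admissible_prime (p m : nat) : prime p ->
  admissible p m = odd m && ((m == p) || ~~ (p %| m)).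
Proof.
move=> p_prime; rewrite /admissible; case odd_m: (odd m) => //=.
rewrite (odd_gt0 odd_m) /= -[RHS]negbK negb_or negbK; congr negb.
apply/(proper_multipleP _ p_prime)/andP => [[k k_ge2 ->]|[m_neq_p]].
  have p_gt1 := prime_gt1 p_prime.
  by rewrite dvdn_mulr // -[X in _ != X]muln1 eqn_pmul2l ?prime_gt0 //; lia.
case/dvdnP=> k m_kp; exists k; last by rewrite mulnC.
by case: k m_kp => [|[|k]] m_kp //; lia.
Qed.

Definition good (m : nat) : bool :=
  [&& odd m, (m == 3) || ~~ (3 %| m) & (m == 5) || ~~ (5 %| m)].

Lemma good_admissible (m : nat) : admissible 3 m && admissible 5 m = good m.
Proof. by rewrite !admissible_prime // /good; case: (odd m). Qed.

Definition link (x y : nat) : bool := good (x + y) && good `|x - y|.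

Definition stable_link (x y : nat) : bool := (5 < x + y) && link x y.

Lemma stable_link_link : subrel stable_link link.
Proof. by move=> x y /andP[]. Qed.

Lemma good_add30 (d m : nat) : 30 %| d -> 5 < m -> good (d + m) = good m.
Proof. by rewrite /good; lia. Qed.

Lemma stable_link_add15 (d : nat) : 15 %| d ->
  {homo addn d : x y / stable_link x y}.
Proof.
move=> d15 x y /andP[sum_gt5 /andP[good_sum good_dist]].
rewrite /stable_link /link distnDl good_dist andbT addnACA.
by rewrite good_add30 ?good_sum //; lia.
Qed.

Lemma path_link_add15 (d x : nat) (s : seq nat) : 15 %| d ->
  path stable_link x s -> path link (d + x) (map (addn d) s).
Proof.
move/stable_link_add15/homo_path=> shift_path /shift_path.
exact: sub_path stable_link_link _ _.
Qed.

Lemma exists_smaller_link (x : nat) : 1 < x ->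
  exists2 y, 0 < y < x & link x y.
Proof.
move=> x_gt1; have [x_le5|x_gt5] := leqP x 5.
  case: x x_gt1 x_le5 => [|[|[|[|[|[]]]]]] // _ _.
  - by exists 1.
  - by exists 2.
  - by exists 3.
  - by exists 2.
have link_sub d : d < 6 -> good d -> good (x + (x - d)) ->
    exists2 y, 0 < y < x & link x y.
  case: d => // d d_lt6 good_d good_sum; exists (x - d.+1); first lia.
  by rewrite /link good_sum distnEl ?leq_subr // subKn //; lia.
have [|not1] := boolP (good (x + (x - 1))); first exact: link_sub.
have [|not3] := boolP (good (x + (x - 3))); first exact: link_sub.
by apply: (link_sub 5) => //; move: not1 not3; rewrite /good; lia.
Qed.

Definition closing_path (r : nat) (q : seq nat) : bool :=
  path stable_link 4 (rcons q 3) && perm_eq q (iota 5 r).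

Definition out_strand : seq nat := [:: 7; 10; 13; 16; 21; 26; 27; 34].

Definition in_strand : seq nat :=
  [:: 33; 20; 23; 6; 5; 8; 11; 18; 31; 30; 29; 32; 15; 28; 9; 22; 25; 24; 19;
      12; 17; 14].

(* The j-th entry, found by computer search, is for r = 4 + 2 j; there is no
   closing path for r = 2. *)
Definition closing_paths : seq (seq nat) := [::
  [:: 7; 6; 5; 8];
  [:: 7; 6; 5; 8; 9; 10];
  [:: 7; 6; 5; 12; 11; 8; 9; 10];
  [:: 7; 10; 13; 6; 5; 12; 11; 8; 9; 14];
  [:: 7; 10; 9; 14; 15; 16; 13; 6; 5; 12; 11; 8];
  [:: 7; 10; 9; 14; 15; 16; 13; 18; 11; 12; 17; 6; 5; 8];
  [:: 7; 10; 9; 20; 17; 14; 15; 16; 13; 6; 5; 12; 19; 18; 11; 8];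
  [:: 7; 10; 13; 16; 15; 14; 17; 6; 5; 12; 11; 18; 19; 22; 21; 20; 9; 8];
  [:: 7; 10; 9; 14; 15; 16; 13; 18; 19; 22; 21; 20; 23; 24; 17; 12; 11; 6;
      5; 8];
  [:: 7; 10; 9; 14; 15; 16; 13; 18; 19; 22; 21; 26; 23; 20; 17; 24; 25; 12;
      11; 6; 5; 8];
  [:: 7; 10; 13; 16; 27; 26; 23; 20; 21; 28; 15; 14; 9; 22; 19; 18; 25; 24;
      17; 12; 11; 6; 5; 8];
  [:: 7; 10; 9; 14; 27; 26; 15; 16; 13; 6; 5; 8; 11; 12; 17; 30; 29; 24; 23;
      18; 19; 22; 25; 28; 21; 20];
  [:: 7; 10; 13; 16; 27; 26; 23; 20; 21; 32; 29; 30; 31; 28; 15; 14; 9; 22;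
      19; 18; 25; 24; 17; 12; 11; 6; 5; 8];
  out_strand ++ in_strand;
  [:: 7; 10; 9; 8; 11; 6; 5; 12; 19; 22; 25; 28; 31; 30; 29; 18; 13; 24; 35;
      36; 23; 20; 17; 14; 33; 34; 27; 26; 21; 32; 15; 16]].

Lemma closing_pathsP (j : nat) : j < 15 ->
  closing_path (4 + 2 * j) (nth [::] closing_paths j).
Proof.
suff /allP all_closing : all
    (fun i => closing_path (4 + 2 * i) (nth [::] closing_paths i)) (iota 0 15).
  by move=> j_lt15; apply: all_closing; rewrite mem_iota.
by vm_compute.
Qed.

Lemma perm_iota_shift (d m n : nat) (s : seq nat) :
  perm_eq s (iota m n) -> perm_eq (map (addn d) s) (iota (d + m) n).
Proof. by rewrite iotaDl; apply: perm_map. Qed.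

Lemma periodic_spanning_path (k : nat) :
  spanning_path link (iota 1 (30 * k + 4)) (30 * k + 3) (30 * k + 4).
Proof.
elim: k => [|k IHk]; first by exists [:: 2; 1; 4].
have dvd15 : 15 %| 30 * k by rewrite dvdn_mulr.
pose shift := map (addn (30 * k)).
have -> : 30 * k.+1 + 3 = 30 * k + 33 by lia.
have -> : 30 * k.+1 + 4 = 30 * k + 4 + 30 by lia.
have {2}-> : 30 * k + 4 + 30 = last (30 * k + 4) (shift out_strand).
  by rewrite -addnA.
rewrite iotaD add1n -addnS.
apply: (spanning_path_extend (p := shift (behead in_strand)) IHk).
- by rewrite -map_rcons; apply: (path_link_add15 dvd15).
- exact: (path_link_add15 dvd15).
- by rewrite -map_cat -map_cons; apply: perm_iota_shift.
Qed.

Lemma even_spanning_cycle (n : nat) :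
  ~~ odd n -> spanning_cycle link (iota 1 n).
Proof.
have [n_lt8 even_n|n_ge8 even_n] := ltnP n 8.
  case: n n_lt8 even_n => [|[|[|[|[|[|[|[|]]]]]]]] // _ _.
  - by exists [::].
  - by exists [:: 1; 2].
  - by exists [:: 1; 2; 3; 4].
  - by exists [:: 1; 4; 3; 2; 5; 6].
pose j := ((n - 8) %% 30)./2; pose k := (n - 8) %/ 30.
have dvd15 : 15 %| 30 * k by rewrite dvdn_mulr.
have j_lt15 : j < 15 by rewrite /j; lia.
have /andP[path_q perm_q] := closing_pathsP j_lt15.
have -> : n = 30 * k + 4 + (4 + 2 * j) by rewrite /j /k; lia.
rewrite iotaD add1n -addnS.
apply: spanning_path_close (periodic_spanning_path k) _
  (perm_iota_shift (30 * k) perm_q).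
by rewrite -map_rcons; apply: (path_link_add15 dvd15).
Qed.

Lemma traceable_link (n : nat) : traceable link (iota 1 n).
Proof.
have [odd_n|/even_spanning_cycle] := boolP (odd n); last first.
  exact: spanning_cycle_traceable.
case: n odd_n => // n even_n.
have [->|n_gt0] := posnP n; first by exists [:: 1].
have [//|y y_bounds link_y] := @exists_smaller_link n.+1 _.
rewrite -[X in iota _ X]addn1 iotaD cats1 add1n.
apply: spanning_cycle_rcons (even_spanning_cycle even_n) _ link_y.
by rewrite mem_iota add1n.
Qed.

Definition half_label (n : nat) (v : vertex n) : nat := (val v)./2.

Lemma half_labelK (n : nat) (v : vertex n) : 2 * half_label v = val v.
Proof.
have /mapP[i _ v_2i] := ssvalP v.
by rewrite /half_label /= v_2i [in half _]mul2n doubleK.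
Qed.

Lemma half_label_inj (n : nat) : injective (@half_label n).
Proof. by move=> u v uv; apply: val_inj; rewrite -!half_labelK uv. Qed.

Lemma G35_link (n : nat) (u v : vertex n) :
  G35 n u v = link (half_label u) (half_label v).
Proof.
rewrite /= /G_rel -!half_labelK.
set x := half_label u; set y := half_label v.
have -> : (2 * x + 2 * y)./2 = x + y by rewrite -mulnDr mul2n doubleK.
have -> : `|2 * x - 2 * y|./2 = `|x - y| by lia.
have [uv|_] := eqVneq u v; last first.
  by rewrite /link -!good_admissible [RHS]andbACA.
by rewrite /x /y uv /link distnn [RHS]andbF.
Qed.

Lemma lift_vertices (n : nat) (l : seq nat) : perm_eq l (iota 1 n) ->
  exists s : seq (vertex n),
    [/\ map (@half_label n) s = l, uniq s & forall v, v \in s].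
Proof.
move=> perm_l.
have [s val_s] : exists s : seq (vertex n), map val s = map (muln 2) l.
  exists (pmap insub (map (muln 2) l)).
  rewrite (pmap_filter (insubK _)); apply/all_filterP/allP => i.
  by rewrite (perm_mem (perm_map _ perm_l)) => i_label; rewrite insubT.
have half_s : map (@half_label n) s = l.
  apply: (@inj_map _ _ (muln 2)); first by move=> i j; lia.
  by rewrite -map_comp -val_s; apply: eq_map => v; apply: half_labelK.
exists s; split=> //.
  rewrite -(map_inj_uniq (@half_label_inj n)) half_s (perm_uniq perm_l).
  exact: iota_uniq.
move=> v; rewrite -(mem_map val_inj) val_s (perm_mem (perm_map _ perm_l)).
exact: ssvalP.
Qed.

Lemma traceable_hamiltonian_path (n : nat) :
  traceable link (iota 1 n) -> has_hamiltonian_path (G35 n).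
Proof.
case=> l sorted_l /lift_vertices[s [half_s uniq_s full_s]].
exists s; split=> //; move: sorted_l; rewrite -half_s sorted_map.
by apply: sub_sorted => u v; rewrite G35_link.
Qed.

Lemma spanning_cycle_hamiltonian (n : nat) :
  2 < n -> spanning_cycle link (iota 1 n) -> hamiltonian (G35 n).
Proof.
move=> n_gt2 [l cycle_l perm_l].
have [s [half_s uniq_s full_s]] := lift_vertices perm_l.
exists s; split=> //.
  rewrite /ucycle uniq_s andbT; move: cycle_l; rewrite -half_s cycle_map.
  by apply: sub_cycle => u v; rewrite G35_link.
by rewrite -(size_map (@half_label n)) half_s (perm_size perm_l) size_iota.
Qed.

Theorem theorem6p3 :
  (forall n : nat, has_hamiltonian_path (G35 n)) /\
  (forall n : nat, ~~ odd n -> 2 < n -> hamiltonian (G35 n)).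
Proof.
split=> [n|n even_n n_gt2].
  exact/traceable_hamiltonian_path/traceable_link.
exact/spanning_cycle_hamiltonian/even_spanning_cycle.
Qed.
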